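(* The set of Tarski's axioms (R1)--(R10) is independent. That is, for each $n\in\{1,\dots,10\}$, axiom (R$n$) is not derivable from the other nine axioms: there is an algebra $\mathfrak{A}_n=(A,+,-,;,{}^{\smile},1')$ in which (R$n$) fails and in which (R$m$) is valid for every $m\in\{1,\dots,10\}$ with $m\neq n$.
   Context: All algebras have the form $\mathfrak{A}=(A,+,-,;,{}^{\smile},1')$, where $A$ is a non-empty set, $+$ and $;$ are binary operations on $A$, $-$ and ${}^{\smile}$ are unary operations on $A$, and $1'$ is a distinguished element of $A$. Unary operations bind more tightly than binary ones, and $;$ binds more tightly than $+$. An axiom is valid in $\mathfrak{A}$ if it holds for all elements $r,s,t\in A$; otherwise it fails in $\mathfrak{A}$. Tarski's axioms are: (R1) $r+s=s+r$; (R2) $r+(s+t)=(r+s)+t$; (R3) $-(-r+s)+-(-r+-s)=r$; (R4) $r;(s;t)=(r;s);t$; (R5) $r;1'=r$; (R6) $(r^{\smile})^{\smile}=r$; (R7) $(r;s)^{\smile}=s^{\smile};r^{\smile}$; (R8) $(r+s);t=r;t+s;t$; (R9) $(r+s)^{\smile}=r^{\smile}+s^{\smile}$; (R10) $r^{\smile};-(r;s)+-s=-s$, i.e. $\bigl((r^{\smile});(-(r;s))\bigr)+(-s)=-s$. A set of axioms is independent if none of the axioms in it can be derived from the remaining ones; for each axiom this is witnessed by a model in which that axiom fails and all the remaining axioms are valid. *)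

(* Defs.v *)
Set Implicit Arguments.
Unset Strict Implicit.
Unset Printing Implicit Defensive.

(* Non-emptiness of the carrier is witnessed by [ident]. *)
Record algebra : Type := Algebra {
  carrier :> Type;
  add : carrier -> carrier -> carrier;
  compl : carrier -> carrier;
  comp : carrier -> carrier -> carrier;
  conv : carrier -> carrier;
  ident : carrier
}.

Arguments ident {_}.

Declare Scope ra_scope.
Delimit Scope ra_scope with ra.
Notation "r + s" := (add r s) (at level 50, left associativity) : ra_scope.
Notation "- r" := (compl r) (at level 35, right associativity) : ra_scope.
Notation "r ;; s" := (comp r s) (at level 40, left associativity) : ra_scope.
Notation "r ^~" := (conv r) (at level 2, left associativity, format "r ^~") :
  ra_scope.
Notation "1'" := ident : ra_scope.

Inductive axiom : Set := R1 | R2 | R3 | R4 | R5 | R6 | R7 | R8 | R9 | R10.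

Local Open Scope ra_scope.

Definition valid (A : algebra) (n : axiom) : Prop :=
  match n with
  | R1 => forall r s : A, r + s = s + r
  | R2 => forall r s t : A, r + (s + t) = (r + s) + t
  | R3 => forall r s : A, -(-r + s) + -(-r + -s) = r
  | R4 => forall r s t : A, r ;; (s ;; t) = (r ;; s) ;; t
  | R5 => forall r : A, r ;; 1' = r
  | R6 => forall r : A, (r^~)^~ = r
  | R7 => forall r s : A, (r ;; s)^~ = s^~ ;; r^~
  | R8 => forall r s t : A, (r + s) ;; t = r ;; t + s ;; t
  | R9 => forall r s : A, (r + s)^~ = r^~ + s^~
  | R10 => forall r s : A, r^~ ;; -(r ;; s) + -s = -s
  end.

(* Main.v *)
(** Finite models suffice.  Those for (R4)-(R10) have the Boolean algebra with
    one, two or three atoms as reduct.  The hard one is (R9): if [;;] were also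
    distributive on the right, (R10) would make left multiplication by [r^~] the
    conjugate of left multiplication by [r], and since conjugates are unique and
    conjugation preserves joins, (R9) would follow by evaluating at [1'].  So
    that model must be non-distributive on the right. *)
From Stdlib Require Import Bool.
Require Import Defs.

Definition witnesses (n : axiom) (A : algebra) : Prop :=
  ~ valid A n /\ (forall m : axiom, m <> n -> valid A m).

Ltac split_elements :=
  repeat match goal with
         | x : carrier _ |- _ => destruct x
         | x : (_ * _)%type |- _ => destruct x
         | x : bool |- _ => destruct x
         | x : comparison |- _ => destruct x
         end.

Ltac check_axioms :=
  intros m ne; destruct m; try (contradiction ne; reflexivity);
  clear ne; cbn [valid carrier]; intros; split_elements; reflexivity.

(* In a group [r^~ ;; (r ;; s) = s], so (R10) holds for a left-projection sum. *)
Definition model1 : algebra :=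
  @Algebra bool (fun r _ => r) (fun r => r) xorb (fun r => r) false.

Lemma model1P : witnesses R1 model1.
Proof.
split; [intros H; discriminate (H true false) | check_axioms].
Qed.

(* The field of three elements [Lt = -1], [Eq = 0], [Gt = 1], with its sum
   replaced by the sum truncated to the interval [-1, 1]. *)
Definition truncated_add (r s : comparison) : comparison :=
  match r, s with
  | Eq, t | t, Eq => t
  | Lt, Lt => Lt
  | Gt, Gt => Gt
  | _, _ => Eq
  end.

Definition sign_mul (r s : comparison) : comparison :=
  match r with Lt => CompOpp s | Eq => Eq | Gt => s end.

Definition model2 : algebra :=
  @Algebra comparison truncated_add CompOpp sign_mul (fun r => r) Gt.

Lemma model2P : witnesses R2 model2.
Proof.
split; [intros H; discriminate (H Gt Gt Lt) | check_axioms].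
Qed.

(** As [-] is the identity, (R3) would force [r + s = r], while (R10) is the absorption law. *)
Definition model3 : algebra :=
  @Algebra bool orb (fun r => r) andb (fun r => r) true.

Lemma model3P : witnesses R3 model3.
Proof.
split; [intros H; discriminate (H false true) | check_axioms].
Qed.

Definition or3 (r s : bool * bool * bool) : bool * bool * bool :=
  let '(r0, r1, r2) := r in let '(s0, s1, s2) := s in
  (r0 || s0, r1 || s1, r2 || s2).

Definition neg3 (r : bool * bool * bool) : bool * bool * bool :=
  let '(r0, r1, r2) := r in (negb r0, negb r1, negb r2).

(* Complex product for atoms [1', a, b] with [a;a = b;b = 1'], [a;b = b;a = 0];
   thus [(a;a);b = b] but [a;(a;b) = 0]. *)
Definition nonassociative_comp (r s : bool * bool * bool) :
    bool * bool * bool :=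
  let '(r0, r1, r2) := r in let '(s0, s1, s2) := s in
  (r0 && s0 || r1 && s1 || r2 && s2,
   r0 && s1 || r1 && s0,
   r0 && s2 || r2 && s0).

Definition model4 : algebra :=
  @Algebra (bool * bool * bool) or3 neg3 nonassociative_comp
    (fun r => r) (true, false, false).

Lemma model4P : witnesses R4 model4.
Proof.
split; [|check_axioms].
intros H.
discriminate (H (false, true, false) (false, true, false) (false, false, true)).
Qed.

Definition model5 : algebra :=
  @Algebra bool orb negb (fun _ _ => false) (fun r => r) true.

Lemma model5P : witnesses R5 model5.
Proof.
split; [intros H; discriminate (H true) | check_axioms].
Qed.

Definition model6 : algebra :=
  @Algebra bool orb negb andb (fun _ => false) true.

Lemma model6P : witnesses R6 model6.
Proof.
split; [intros H; discriminate (H true) | check_axioms].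
Qed.

Definition or2 (r s : bool * bool) : bool * bool :=
  (fst r || fst s, snd r || snd s).

Definition neg2 (r : bool * bool) : bool * bool := (negb (fst r), negb (snd r)).

(* [1' = (true, false)] is only a right identity. *)
Definition one_sided_comp (r s : bool * bool) : bool * bool :=
  match s with (true, false) => r | _ => (false, false) end.

Definition model7 : algebra :=
  @Algebra (bool * bool) or2 neg2 one_sided_comp (fun r => r) (true, false).

Lemma model7P : witnesses R7 model7.
Proof.
split; [|check_axioms].
intros H; discriminate (H (true, false) (false, true)).
Qed.

(** [negb] is a translation of the group, so [r^~ ;; -(r ;; s) = -s]. *)
Definition model8 : algebra :=
  @Algebra bool orb negb xorb (fun r => r) false.

Lemma model8P : witnesses R8 model8.
Proof.
split; [intros H; discriminate (H true false true) | check_axioms].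
Qed.

Definition rotate (r : bool * bool * bool) : bool * bool * bool :=
  let '(r0, r1, r2) := r in (r2, r0, r1).

(* Left multiplication by the atom [a = (false, true, false)]: it rotates the
   atoms forwards and the coatoms backwards, so that it sends [- s] to the
   complement of the image of [s] under the inverse rotation; this is (R10)
   for [a^~ = a]. *)
Definition twist (r : bool * bool * bool) : bool * bool * bool :=
  match r with
  | (true, true, false) | (true, false, true) | (false, true, true) =>
      rotate (rotate r)
  | _ => rotate r
  end.

Definition scale3 (c : bool) (r : bool * bool * bool) : bool * bool * bool :=
  if c then r else (false, false, false).

(** [twist] has order three, so the atoms form a cyclic group; joining over the atoms of [r] ensures
    (R8). *)
Definition twisted_comp (r s : bool * bool * bool) : bool * bool * bool :=
  let '(r0, r1, r2) := r in
  or3 (or3 (scale3 r0 s) (scale3 r1 (twist s))) (scale3 r2 (twist (twist s))).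

(* Exchanges [1' + a] and [1' + b] and fixes every other element, in particular
   all the atoms. *)
Definition twisted_conv (r : bool * bool * bool) : bool * bool * bool :=
  match r with
  | (true, r1, r2) => (true, r2, r1)
  | _ => r
  end.

Definition model9 : algebra :=
  @Algebra (bool * bool * bool) or3 neg3 twisted_comp twisted_conv
    (true, false, false).

Lemma model9P : witnesses R9 model9.
Proof.
split; [|check_axioms].
intros H; discriminate (H (true, false, false) (false, true, false)).
Qed.

(** (R8) holds since join is idempotent. *)
Definition model10 : algebra :=
  @Algebra bool orb negb orb (fun r => r) false.

Lemma model10P : witnesses R10 model10.
Proof.
split; [intros H; discriminate (H true true) | check_axioms].
Qed.

Theorem theorem1 :
  forall n : axiom,
    exists A : algebra,
      ~ valid A n /\ (forall m : axiom, m <> n -> valid A m).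
Proof.
intros [].
- exact (ex_intro _ _ model1P).
- exact (ex_intro _ _ model2P).
- exact (ex_intro _ _ model3P).
- exact (ex_intro _ _ model4P).
- exact (ex_intro _ _ model5P).
- exact (ex_intro _ _ model6P).
- exact (ex_intro _ _ model7P).
- exact (ex_intro _ _ model8P).
- exact (ex_intro _ _ model9P).
- exact (ex_intro _ _ model10P).
Qed.
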